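(* There are infinitely many pairwise nonequivalent quintuples $\{a_1,\dots,a_5\}$ of distinct nonzero integers such that all of $a_1,\dots,a_5$ are perfect squares and $\{a_1,\dots,a_5\}$ is a $D(n_1)$-quintuple for some $n_1\in\mathbb{N}$ (where $n_1$ may depend on the quintuple). In particular (taking $n_2=0$), there are infinitely many pairwise nonequivalent integer quintuples each of which is simultaneously a $D(n_1)$-quintuple and a $D(n_2)$-quintuple for some integers $n_1\neq n_2$.
   Context: For an integer $n$, a $D(n)$-quintuple is a set $\{a_1,\dots,a_5\}$ of five distinct nonzero integers such that $a_ia_j+n$ is a perfect square (the square of an integer) for all $1\le i<j\le 5$. Here $\mathbb{N}$ denotes the positive integers. If $\{a,b,c,d,e\}$ is a $D(n_1)$-quintuple and $u$ is a nonzero rational, then $\{ua,ub,uc,ud,ue\}$ is a $D(n_1u^2)$-quintuple (with rational elements in general), and the two quintuples are called equivalent; that is, two quintuples are equivalent if one is obtained from the other by multiplying all elements by a common nonzero rational number $u$. *)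

(* Defs.v *)
From HB Require Import structures.
From mathcomp Require Import all_boot all_order all_algebra.
From mathcomp Require Import finmap.

Set Implicit Arguments.
Unset Strict Implicit.
Unset Printing Implicit Defensive.

Import Order.TTheory GRing.Theory Num.Theory.
Local Open Scope ring_scope.
Local Open Scope fset_scope.

Definition perfect_square (m : int) : Prop := exists k : int, m = k ^+ 2.

Definition quintuple (A : {fset int}) : Prop := #|` A| = 5%N /\ 0 \notin A.

Definition D_quintuple (n : int) (A : {fset int}) : Prop :=
  quintuple A /\
  forall a b : int, a \in A -> b \in A -> a != b -> perfect_square (a * b + n).

Definition equivalent (A B : {fset int}) : Prop :=
  exists u : rat, u != 0 /\
    [fset u * a%:~R | a in A] = [fset b%:~R | b in B] :> {fset rat}.

(* Q is injective, since [equivalent] is reflexive. *)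
Definition infinitely_many_pairwise_nonequivalent
    (P : {fset int} -> Prop) : Prop :=
  exists Q : nat -> {fset int},
    (forall i, P (Q i)) /\ (forall i j, i != j -> ~ equivalent (Q i) (Q j)).

(* Main.v *)
Require Import Defs.
From HB Require Import structures.
From mathcomp Require Import all_boot all_order all_algebra.
From mathcomp Require Import finmap.
From mathcomp Require Import ring zify.

(** When [n] is a square, dividing the elements of a D(n)-quintuple of squares
    by [sqrt n] gives a rational quintuple such that the product of any two
    elements is a square and remains a square when 1 is added; conversely, such
    a rational quintuple is a multiple of a D(n)-quintuple of integer squares.
    It is sought in the form [{a, b, c, d, e}] where [d] and [e] are the two
    regular extensions [a + b + c + 2abc +- 2 sqrt ((ab+1)(ac+1)(bc+1))] of the
    triple [{a, b, c}], so that [ad+1], ..., [ce+1] are squares as soon as [ab+1],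
    [ac+1] and [bc+1] are.  Imposing moreover [acde = 1], with [ac = q^2],
    makes [de+1 = (ac+1)/(ac)] a square, and it is solved by
    [b = a + c + 2q + 1/q].  Writing [a = q(1/z - 1)], everything then reduces
    to the condition that
      [q^2 + 1],  [q^2 + z],  [q^2 + 1 - z],  [q^2 + z(1 - z)]
    be squares.  On the surface defined by these four conditions lies the curve
    of genus one [q = 6u/X], [z = (X - 24)/X], where
      [X + 3 = 3 u^2],   [X + 1 = v^2],   [X - 15 = w^2].      (C)
    After multiplication by a common factor, the quintuple attached to a point
    of (C) consists of the squares of
      [24u],  [u(X - 24)],  [wX],  [v(X - 6) + u(X + 6)],
      [v(X - 6) - u(X + 6)],
    with [n = (4uX(X - 24))^2]; in this form the ten conditions are polynomial
    identities modulo (C) ([square12], ..., [square45]).  Integers are obtained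
    from a rational point by using homogeneous coordinates [(u : v : w : k)].

    The curve (C) covers the elliptic curve
    [E : y^2 = xi (xi - 6)(xi - 54)], with [xi = 3(X + 3)], and its points lie
    above the coset [P + 2E(Q)], where [P = (81, 405)].  The point [P] itself
    has [X = 24] and the quintuple degenerates there, but [P] has infinite
    order because [xi(2P) = (77/10)^2] is not an integer.  For
    [j = 1, 2, 3, ...] the points [2^j P] tend to the origin in the 2-adic
    topology ([point_spec]), hence the points [P + 2^j P] tend to [P] without
    being equal to it.  Near [P] the 2-adic valuations of the five elements
    show that these are distinct and nonzero ([uniq_squares], [roots_neq0]).
    The valuation of [u(X - 24)] tends to infinity whereas that of [24u] stays
    bounded, so the largest difference of valuations inside the quintuple, which
    is invariant under equivalence ([equivalent_spread]), is unbounded; an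
    unbounded invariant provides infinitely many classes
    ([infinitely_many_of_unbounded_spread]).

    The second assertion follows with [n_2 = 0], since a product of two squares
    is a square. *)

Set Implicit Arguments.
Unset Strict Implicit.
Unset Printing Implicit Defensive.

Import Order.TTheory GRing.Theory Num.Theory.
Local Open Scope fset_scope.
Local Open Scope ring_scope.

(** * The 2-adic spread, an invariant of equivalence *)

Definition spread (A : {fset int}) : nat :=
  (\max_(a <- A) \max_(b <- A) (logn 2 `|a| - logn 2 `|b|))%N.

Lemma leq_spread (A : {fset int}) (a b : int) :
  a \in A -> b \in A -> (logn 2 `|a| - logn 2 `|b| <= spread A)%N.
Proof.
move=> aA bA; apply: leq_trans (leq_bigmax_seq (P := predT)
  (F := fun a => (\max_(b <- A) (logn 2 `|a| - logn 2 `|b|))%N) _ aA isT).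
exact: (leq_bigmax_seq (P := predT)
  (F := fun b : int => (logn 2 `|a| - logn 2 `|b|)%N) _ bA isT).
Qed.

(** Scaling by [u] adds the valuation of [u] to all the valuations, hence
    preserves their differences; comparing the cross products [a * b'] and
    [a' * b] does this without valuations on the rationals. *)
Lemma spread_scale_leq (A B : {fset int}) (u : rat) :
    0 \notin A -> 0 \notin B ->
    (forall a : int, a \in A -> exists2 b : int, b \in B & u * a%:~R = b%:~R) ->
  (spread A <= spread B)%N.
Proof.
move=> A0 B0 AB.
apply/bigmax_leqP_seq => a aA _; apply/bigmax_leqP_seq => b bA _.
have [a' a'B ua] := AB a aA; have [b' b'B ub] := AB b bA.
have nz (C : {fset int}) c : 0 \notin C -> c \in C -> (0 < `|c|)%N.
  by move=> C0 cC; rewrite absz_gt0; apply: contraNneq C0 => <-.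
have cross : a * b' = a' * b.
  by apply: (@intr_inj rat); rewrite !intrM -ua -ub; ring.
have : logn 2 `|a * b'| = logn 2 `|a' * b| by rewrite cross.
rewrite !abszM !lognM ?(nz A a) ?(nz A b) ?(nz B a') ?(nz B b') // => vab.
apply: leq_trans (leq_spread a'B b'B); lia.
Qed.

Lemma equivalent_spread (A B : {fset int}) :
  0 \notin A -> 0 \notin B -> equivalent A B -> spread A = spread B.
Proof.
move=> A0 B0 [u [u0 /fsetP eqAB]]; apply/eqP; rewrite eqn_leq; apply/andP; split.
  apply: (@spread_scale_leq A B u) => // a aA.
  have: u * a%:~R \in [fset u * a%:~R | a in A] by apply: in_imfset.
  by rewrite eqAB => /imfsetP[b bB ->]; exists b.
apply: (@spread_scale_leq B A u^-1) => // b bB.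
have: b%:~R \in [fset (b%:~R : rat) | b in B] by apply: in_imfset.
by rewrite -eqAB => /imfsetP[a aA ->]; exists a => //; rewrite mulKf.
Qed.

Lemma infinitely_many_of_unbounded_spread
    (P : {fset int} -> Prop) (A : nat -> {fset int}) :
    (forall n, P (A n)) -> (forall n, 0 \notin A n) ->
    (forall n, (n <= spread (A n))%N) ->
  infinitely_many_pairwise_nonequivalent P.
Proof.
(* A subsequence along which the spread increases strictly. *)
move=> PA A0 Aub.
pose g := fix g n := if n is m.+1 then (spread (A (g m))).+1 else 0%N.
have gS n : (spread (A (g n)) < spread (A (g n.+1)))%N by apply: Aub.
have mono : {homo (fun n => spread (A (g n))) : i j / (i < j)%N}.
  exact: homo_ltn ltn_trans gS.
exists (A \o g); split=> [i|i j neq_ij]; first exact: PA.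
move/(equivalent_spread (A0 _) (A0 _)) => /= eqs.
by case: (ltngtP i j) neq_ij => // /mono; rewrite /= eqs ltnn.
Qed.

(** * The quintuple attached to a point of the curve (C) *)

Section Squares.
Variables u v w k : int.

(** For the point [(u : v : w : k)] this is [X * k ^+ 2]. *)
Definition abscissa : int := 3 * (u ^+ 2 - k ^+ 2).
Local Notation x := abscissa.

Definition root1 : int := 24 * u * k ^+ 2.
Definition root2 : int := u * (x - 24 * k ^+ 2).
Definition root3 : int := w * x.
(** The fourth and fifth elements are conjugate: [u] and [- u] give one each. *)
Definition root4 : int := v * (x - 6 * k ^+ 2) + u * (x + 6 * k ^+ 2).

Definition shift : int := (4 * u * k * x * (x - 24 * k ^+ 2)) ^+ 2.

Hypothesis hv : v ^+ 2 = x + k ^+ 2.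
Hypothesis hw : w ^+ 2 = x - 15 * k ^+ 2.

(** Membership in the ideal of the curve, certified by the cofactors [c1] and
    [c2] of its two equations. *)
Lemma eq_on_curve (c1 c2 a b : int) :
  a - b = c1 * (v ^+ 2 - (x + k ^+ 2)) + c2 * (w ^+ 2 - (x - 15 * k ^+ 2)) ->
  a = b.
Proof. by rewrite hv hw !subrr !mulr0 addr0 => /eqP; rewrite subr_eq0 => /eqP. Qed.

Ltac on_curve c1 c2 := apply: (@eq_on_curve c1 c2);
  rewrite /root1 /root2 /root3 /root4 /shift /abscissa; ring.

Lemma square12 : root1 ^+ 2 * root2 ^+ 2 + shift =
  (4 * u * k * (x - 24 * k ^+ 2) * (x + 6 * k ^+ 2)) ^+ 2.
Proof. by rewrite /root1 /root2 /shift /abscissa; ring. Qed.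

Lemma square13 : root1 ^+ 2 * root3 ^+ 2 + shift =
  (4 * u * k * x * (x - 6 * k ^+ 2)) ^+ 2.
Proof. on_curve (0 : int) (root1 ^+ 2 * x ^+ 2). Qed.

Lemma square23 : root2 ^+ 2 * root3 ^+ 2 + shift =
  (u * x * (x - 24 * k ^+ 2) * v) ^+ 2.
Proof.
on_curve (- (u * x * (x - 24 * k ^+ 2)) ^+ 2) ((u * x * (x - 24 * k ^+ 2)) ^+ 2).
Qed.

Lemma square14 : root1 ^+ 2 * root4 ^+ 2 + shift =
  (4 * u * k * (x ^+ 2 - 36 * k ^+ 4 + 36 * k ^+ 2 * u * v)) ^+ 2.
Proof.
on_curve (root1 ^+ 2 * ((x - 6 * k ^+ 2) ^+ 2 - 36 * k ^+ 2 * u ^+ 2)) (0 : int).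
Qed.

Lemma square24 : root2 ^+ 2 * root4 ^+ 2 + shift =
  (u * (x - 24 * k ^+ 2) * (u * (x - 6 * k ^+ 2) + v * (x + 6 * k ^+ 2))) ^+ 2.
Proof.
on_curve (root2 ^+ 2 * ((x - 6 * k ^+ 2) ^+ 2 - (x + 6 * k ^+ 2) ^+ 2)) (0 : int).
Qed.

Lemma square34 : root3 ^+ 2 * root4 ^+ 2 + shift =
  (x * ((x - 15 * k ^+ 2) * (x + 6 * k ^+ 2) + (x - 6 * k ^+ 2) * u * v)) ^+ 2.
Proof.
on_curve (x ^+ 2 * (x - 6 * k ^+ 2) ^+ 2 * (x - 15 * k ^+ 2 - u ^+ 2))
  (x ^+ 2 * root4 ^+ 2).
Qed.

(** The quadratic factor is positive definite, so that [root1] and [root3] have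
    different squares away from [X = 24]. *)
Lemma root13 : root1 ^+ 2 - root3 ^+ 2 =
  - (x - 24 * k ^+ 2) * (x ^+ 2 + 9 * x * k ^+ 2 + 24 * k ^+ 4).
Proof. on_curve (0 : int) (- x ^+ 2). Qed.

End Squares.

Lemma abscissaN (u k : int) : abscissa (- u) k = abscissa u k.
Proof. by rewrite /abscissa sqrrN. Qed.

Lemma shiftN (u k : int) : shift (- u) k = shift u k.
Proof. by rewrite /shift abscissaN; ring. Qed.

Section Quintuple.
Variables u v w k : int.
Local Notation x := (abscissa u k).
Hypothesis hv : v ^+ 2 = x + k ^+ 2.
Hypothesis hw : w ^+ 2 = x - 15 * k ^+ 2.

(** This is the relation [acde = 1]; it determines the valuation of the fifth
    root from that of the fourth. *)
Lemma root45 : root4 u v k * root4 (- u) v k =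
  2 * (u ^+ 2 - k ^+ 2) * x * (x - 24 * k ^+ 2).
Proof.
apply: (eq_on_curve hv hw (c1 := (x - 6 * k ^+ 2) ^+ 2) (c2 := 0)).
by rewrite /root4 /abscissa; ring.
Qed.

Lemma square45 : root4 u v k ^+ 2 * root4 (- u) v k ^+ 2 + shift u k =
  (2 * (u ^+ 2 - k ^+ 2) * (x - 24 * k ^+ 2) * (x + 6 * k ^+ 2)) ^+ 2.
Proof. by rewrite -exprMn root45 /shift /abscissa; ring. Qed.

Definition roots : seq int :=
  [:: root1 u k; root2 u k; root3 u w k; root4 u v k; root4 (- u) v k].

Definition quint : {fset int} := [fset a in [seq r ^+ 2 | r <- roots]].

Lemma mem_quint r : r \in roots -> r ^+ 2 \in quint.
Proof. by move=> rr; rewrite in_fset; apply/mapP; exists r. Qed.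

Lemma quint_square a : a \in quint -> perfect_square a.
Proof. by rewrite in_fset => /mapP[r _ ->]; exists r. Qed.

Lemma quint_shift a b :
  a \in quint -> b \in quint -> a != b -> perfect_square (a * b + shift u k).
Proof.
have sym c d : perfect_square (c * d + shift u k) ->
    perfect_square (d * c + shift u k) by rewrite mulrC.
have hvN : v ^+ 2 = abscissa (- u) k + k ^+ 2 by rewrite abscissaN.
have hwN : w ^+ 2 = abscissa (- u) k - 15 * k ^+ 2 by rewrite abscissaN.
have neg1 : root1 (- u) k ^+ 2 = root1 u k ^+ 2 by rewrite /root1; ring.
have neg2 : root2 (- u) k ^+ 2 = root2 u k ^+ 2.
  by rewrite /root2 abscissaN; ring.
have neg3 : root3 (- u) w k = root3 u w k by rewrite /root3 abscissaN.
have h12 : perfect_square (root1 u k ^+ 2 * root2 u k ^+ 2 + shift u k).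
  by rewrite square12; eexists.
have h13 : perfect_square (root1 u k ^+ 2 * root3 u w k ^+ 2 + shift u k).
  by rewrite (square13 hv hw); eexists.
have h23 : perfect_square (root2 u k ^+ 2 * root3 u w k ^+ 2 + shift u k).
  by rewrite (square23 hv hw); eexists.
have h14 : perfect_square (root1 u k ^+ 2 * root4 u v k ^+ 2 + shift u k).
  by rewrite (square14 hv hw); eexists.
have h24 : perfect_square (root2 u k ^+ 2 * root4 u v k ^+ 2 + shift u k).
  by rewrite (square24 hv hw); eexists.
have h34 : perfect_square (root3 u w k ^+ 2 * root4 u v k ^+ 2 + shift u k).
  by rewrite (square34 hv hw); eexists.
have h15 : perfect_square (root1 u k ^+ 2 * root4 (- u) v k ^+ 2 + shift u k).
  by rewrite -neg1 -shiftN (square14 hvN hwN); eexists.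
have h25 : perfect_square (root2 u k ^+ 2 * root4 (- u) v k ^+ 2 + shift u k).
  by rewrite -neg2 -shiftN (square24 hvN hwN); eexists.
have h35 : perfect_square (root3 u w k ^+ 2 * root4 (- u) v k ^+ 2 + shift u k).
  by rewrite -neg3 -shiftN (square34 hvN hwN); eexists.
have h45 : perfect_square (root4 u v k ^+ 2 * root4 (- u) v k ^+ 2 + shift u k).
  by rewrite square45; eexists.
rewrite !in_fset /= !inE.
move=> /orP[/eqP->|/orP[/eqP->|/orP[/eqP->|/orP[/eqP->|/eqP->]]]]
  /orP[/eqP->|/orP[/eqP->|/orP[/eqP->|/orP[/eqP->|/eqP->]]]];
  by rewrite ?eqxx //; auto.
Qed.

(** * Nondegeneracy in a 2-adic neighbourhood of [X = 24] *)

(** The congruences below hold at the points constructed in the next part.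
    They give the roots 1 to 5 the valuations 3, at least 4, 3, 2 and at least
    4. *)
Hypothesis odd_u : (u %% 2)%Z = 1.
Hypothesis odd_w : (w %% 2)%Z = 1.
Hypothesis odd_k : (k %% 2)%Z = 1.
Hypothesis x_mod16 : (x %% 16)%Z = 8.
Hypothesis root4_mod8 : (root4 u v k %% 8)%Z = 4.
Hypothesis dvd16_dist : (16 %| x - 24 * k ^+ 2)%Z.
Hypothesis dist_neq0 : x - 24 * k ^+ 2 != 0.

Lemma oddzM (m n : int) :
  (m %% 2)%Z = 1 -> (n %% 2)%Z = 1 -> ((m * n) %% 2)%Z = 1.
Proof. by move=> om on; rewrite -modzMm om on. Qed.

Lemma root1_mod16 : (root1 u k %% 16)%Z = 8.
Proof.
have := oddzM odd_u (oddzM odd_k odd_k); rewrite /root1 -mulrA -expr2.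
by move: (u * _) => m; clear; lia.
Qed.

Lemma root2_dvd16 : (16 %| root2 u k)%Z.
Proof. exact: dvdz_mull. Qed.

Lemma root3_mod16 : (root3 u w k %% 16)%Z = 8.
Proof.
have [y xE] : exists y, x = 8 * y by exists (x %/ 8)%Z; lia.
have oy : (y %% 2)%Z = 1 by lia.
have := oddzM odd_w oy; rewrite /root3 xE mulrCA.
by move: (w * y) => m; clear; lia.
Qed.

(** The relation [root45] with all the known powers of 2 cancelled. *)
Lemma root45_odd : exists y m : int,
  [/\ y != 0, (m %% 2)%Z = 1, root4 u v k = 4 * m &
   3 * m * root4 (- u) v k = 32 * y ^+ 2 * (x - 24 * k ^+ 2)].
Proof.
exists (x %/ 8)%Z, (root4 u v k %/ 4)%Z.
have xE : x = 8 * (x %/ 8)%Z by move: x_mod16; move: x => z; clear; lia.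
have e4 : root4 u v k = 4 * (root4 u v k %/ 4)%Z.
  by move: root4_mod8; move: (root4 u v k) => z; clear; lia.
split=> //.
- by move: x_mod16; move: x => z; clear; lia.
- by move: root4_mod8; move: (root4 u v k) => z; clear; lia.
apply: (@mulfI _ 4) => //.
transitivity (3 * (4 * (root4 u v k %/ 4)%Z * root4 (- u) v k)); first by ring.
transitivity (2 * (8 * (x %/ 8)%Z) ^+ 2 * (x - 24 * k ^+ 2)); last by ring.
by rewrite -e4 root45 -xE /abscissa; ring.
Qed.

Lemma roots_neq0 : 0 \notin roots.
Proof.
have m1 := root1_mod16; have m3 := root3_mod16.
have [y [m [y0 om e4 e45]]] := root45_odd.
have n2 : root2 u k != 0.
  by rewrite mulf_neq0 //; apply/eqP => u0; move: odd_u; rewrite u0.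
have n5 : root4 (- u) v k != 0.
  have : 32 * y ^+ 2 * (x - 24 * k ^+ 2) != 0 by rewrite !mulf_neq0 ?expf_neq0.
  by rewrite -e45; apply: contraNneq => ->; rewrite mulr0.
move: m1 m3 root4_mod8 n2 n5; rewrite !inE.
move: (root1 u k) (root2 u k) (root3 u w k) (root4 u v k) (root4 _ v k).
by clear; lia.
Qed.

(** The valuations separate the squares of the roots, except for the pairs
    (1, 3), settled by [root13], and (2, 5), where [root45] shows that the
    quotient of the fifth root by the second has positive valuation. *)
Lemma uniq_squares : uniq [seq r ^+ 2 | r <- roots].
Proof.
have m1 := root1_mod16; have m2 := root2_dvd16; have m3 := root3_mod16.
have [y [m [y0 om e4 e45]]] := root45_odd.
have n13 : root1 u k ^+ 2 != root3 u w k ^+ 2.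
  rewrite -subr_eq0 (root13 hv hw) mulf_neq0 ?oppr_eq0 //.
  have k0 : k != 0 by apply/eqP => k0; move: odd_k; rewrite k0.
  have pos : 0 < (2 * x + 9 * k ^+ 2) ^+ 2 + 15 * (k ^+ 2) ^+ 2.
    by rewrite ltr_wpDl ?sqr_ge0 // mulr_gt0 // exprn_even_gt0 ?expf_neq0.
  apply: contraTneq pos => eq0; rewrite [X in 0 < X](_ : _ =
    4 * (x ^+ 2 + 9 * x * k ^+ 2 + 24 * k ^+ 4)); last by ring.
  by rewrite eq0 mulr0.
have n25 : root2 u k ^+ 2 != root4 (- u) v k ^+ 2.
  apply/negP; rewrite eqf_sqr => e.
  have [s [es e5]] : exists s : int, (s = 1 \/ s = -1) /\
      root4 (- u) v k = s * u * (x - 24 * k ^+ 2).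
    case/orP: e => /eqP e; [exists 1 | exists (-1)]; split; auto.
      by rewrite -e /root2 mul1r.
    by rewrite -[LHS]opprK -e /root2; ring.
  have : 3 * s * (m * u) = 32 * y ^+ 2.
    by apply: (mulIf dist_neq0); rewrite -e45 e5; ring.
  move: (oddzM om odd_u) es; move: (m * u) (y ^+ 2) => m' y'; clear.
  by move=> om' [] ->; lia.
have n5 (r : int) : (r %% 16)%Z = 8 -> r ^+ 2 != root4 (- u) v k ^+ 2.
  move=> r8; apply/negP; rewrite eqf_sqr => e.
  have [q [oq e5]] : exists q : int, (q %% 2)%Z = 1 /\ root4 (- u) v k = 8 * q.
    exists (root4 (- u) v k %/ 8)%Z; move: r8 e.
    by move: (root4 (- u) v k) => z; clear; split; lia.
  have : 3 * (m * q) = 4 * (y ^+ 2 * (x - 24 * k ^+ 2)).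
    apply: (@mulfI _ 8) => //.
    transitivity (32 * y ^+ 2 * (x - 24 * k ^+ 2)); last by ring.
    by rewrite -e45 e5; ring.
  move: (oddzM om oq); move: (m * q) (y ^+ 2 * _) => m' y'; clear; lia.
have n54 : root4 u v k ^+ 2 != root4 (- u) v k ^+ 2.
  apply/negP; rewrite eqf_sqr => e.
  have [s [es e5]] : exists s : int,
      (s = 1 \/ s = -1) /\ root4 (- u) v k = 4 * (s * m).
    case/orP: e => /eqP e; [exists 1 | exists (-1)]; split; auto;
      by move: e; rewrite e4; move: (root4 (- u) v k) => z; clear; lia.
  have : 3 * s * (m * m) = 8 * (y ^+ 2 * (x - 24 * k ^+ 2)).
    apply: (@mulfI _ 4) => //.
    transitivity (32 * y ^+ 2 * (x - 24 * k ^+ 2)); last by ring.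
    by rewrite -e45 e5; ring.
  move: (oddzM om om) es; move: (m * m) (y ^+ 2 * _) => m' y'; clear.
  by move=> om' [] ->; lia.
rewrite /= !inE !negb_or n13 n25 n54 !n5 //= !eqf_sqr !negb_or.
move: m1 m2 m3 root4_mod8.
by move: (root1 u k) (root2 u k) (root3 u w k) (root4 u v k); clear; lia.
Qed.

Lemma quint_neq0 : 0 \notin quint.
Proof.
rewrite in_fset; apply/negP => /mapP[r rr /esym/eqP].
by rewrite sqrf_eq0 => /eqP r0; move: roots_neq0; rewrite -r0 rr.
Qed.

Lemma quintuple_quint : quintuple quint.
Proof.
by split; [rewrite card_fseq undup_id ?uniq_squares | exact: quint_neq0].
Qed.

Lemma shift_gt0 : 0 < shift u k.
Proof.
have u0 : u != 0 by apply/eqP => u0; move: odd_u; rewrite u0.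
have k0 : k != 0 by apply/eqP => k0; move: odd_k; rewrite k0.
have x0 : x != 0 by apply/eqP => x0; move: x_mod16; rewrite x0.
by rewrite /shift exprn_even_gt0 //=; do 4!apply: mulf_neq0 => //.
Qed.

(** The first two roots suffice: the valuation of [root1] is 3, while that of
    [root2] is at least that of [X - 24]. *)
Lemma spread_quint (m : nat) :
  (2 ^+ m %| x - 24 * k ^+ 2)%Z -> (2 * m - 6 <= spread quint)%N.
Proof.
move=> dvd_m.
have mem1 : root1 u k ^+ 2 \in quint by rewrite mem_quint ?inE ?eqxx.
have mem2 : root2 u k ^+ 2 \in quint by rewrite mem_quint ?inE ?eqxx ?orbT.
apply: leq_trans (leq_spread mem2 mem1); rewrite !abszX !lognX.
have v1 : (logn 2 `|root1 u k| <= 3)%N.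
  have m1 := root1_mod16.
  rewrite leqNgt -pfactor_dvdn //.
    by apply: contra_eqN m1 => d16; move: d16; clear; lia.
  by move: m1; clear; lia.
have v2 : (m <= logn 2 `|root2 u k|)%N.
  rewrite -pfactor_dvdn //.
    have : (2 ^+ m %| root2 u k)%Z by apply: dvdz_mull.
    by rewrite dvdzE abszX.
  rewrite absz_gt0; apply: contraNneq roots_neq0 => r20.
  by rewrite /roots r20 !inE eqxx orbT.
by move: v1 v2; clear; lia.
Qed.

End Quintuple.

(** * Rational points *)

(** A point [xi] of the elliptic curve [y^2 = xi (xi - 6)(xi - 54)] such that
    [xi], [xi - 6] and [xi - 54] are the squares of [p / t], [r / t] and
    [s / t]; these are the nonzero points of [2E(Q)]. *)
Section Translate.
Variables p r s t : int.
Hypothesis hr : r ^+ 2 = p ^+ 2 - 6 * t ^+ 2.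
Hypothesis hs : s ^+ 2 = p ^+ 2 - 54 * t ^+ 2.

Lemma eq_on_E (c1 c2 a b : int) :
  a - b = c1 * (r ^+ 2 - (p ^+ 2 - 6 * t ^+ 2)) +
    c2 * (s ^+ 2 - (p ^+ 2 - 54 * t ^+ 2)) ->
  a = b.
Proof. by rewrite hr hs !subrr !mulr0 addr0 => /eqP; rewrite subr_eq0 => /eqP. Qed.

(** Homogeneous coordinates on (C) of the sum with [P = (81, 405)].  For each
    root [e] of the cubic, the line through two points of [E] shows that
    [xi - e] at their sum is the square of the value of this line at [e] divided
    by the product of the values of [xi - e] at the two points; here [xi - e]
    takes the values 81, 75, 27 at [P]. *)
Definition tk : int := p ^+ 2 - 81 * t ^+ 2.
Definition tu : int := 3 * (5 * p * t - r * s).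
Definition tv : int := 27 * r * t - 5 * p * s.
Definition tw : int := 3 * (15 * s * t - p * r).

Ltac on_E c1 c2 :=
  apply: (@eq_on_E c1 c2); rewrite /tu /tv /tw /tk /abscissa; ring.

Lemma translate_v : tv ^+ 2 = abscissa tu tk + tk ^+ 2.
Proof.
on_E (729 * t ^+ 2 - 27 * s ^+ 2) (25 * p ^+ 2 - 27 * (p ^+ 2 - 6 * t ^+ 2)).
Qed.

Lemma translate_w : tw ^+ 2 = abscissa tu tk - 15 * tk ^+ 2.
Proof.
on_E (9 * p ^+ 2 - 27 * s ^+ 2) (2025 * t ^+ 2 - 27 * (p ^+ 2 - 6 * t ^+ 2)).
Qed.

(** The factor [t] expresses that the sum is 2-adically close to [P] when the
    given point is close to the origin. *)
Lemma translate_dist : abscissa tu tk - 24 * tk ^+ 2 =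
  27 * t * (127 * p ^+ 2 * t - 10 * p * r * s - 6237 * t ^+ 3).
Proof. on_E (27 * s ^+ 2) (27 * (p ^+ 2 - 6 * t ^+ 2)). Qed.

(** With [double_s]: the duplication formula
    [xi(2S) - e = (((xi - e)^2 - (e - e')(e - e'')) / 2y)^2], where [e'] and
    [e''] are the other two roots of the cubic. *)
Lemma double_r : (r ^+ 4 + 288 * t ^+ 4) ^+ 2 =
  (p ^+ 4 - 324 * t ^+ 4) ^+ 2 - 6 * (2 * p * r * s * t) ^+ 2.
Proof.
on_E ((r ^+ 2 + (p ^+ 2 - 6 * t ^+ 2)) *
    (r ^+ 4 + (p ^+ 2 - 6 * t ^+ 2) ^+ 2 + 576 * t ^+ 4)
    + 24 * p ^+ 2 * t ^+ 2 * (p ^+ 2 - 54 * t ^+ 2))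
  (24 * p ^+ 2 * t ^+ 2 * r ^+ 2).
Qed.

Lemma double_s : (s ^+ 4 - 2592 * t ^+ 4) ^+ 2 =
  (p ^+ 4 - 324 * t ^+ 4) ^+ 2 - 54 * (2 * p * r * s * t) ^+ 2.
Proof.
on_E (216 * p ^+ 2 * t ^+ 2 * s ^+ 2)
  ((s ^+ 2 + (p ^+ 2 - 54 * t ^+ 2)) *
    (s ^+ 4 + (p ^+ 2 - 54 * t ^+ 2) ^+ 2 - 5184 * t ^+ 4)
    + 216 * p ^+ 2 * t ^+ 2 * (p ^+ 2 - 6 * t ^+ 2)).
Qed.

Hypothesis p_mod4 : (p %% 4)%Z = 1.
Hypothesis r_mod4 : (r %% 4)%Z = 1.
Hypothesis s_mod4 : (s %% 4)%Z = 1.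
Hypothesis dvd16_t : (16 %| t)%Z.
Hypothesis t_neq0 : t != 0.

Lemma modz_decomp (m d c : int) : (m %% d)%Z = c -> exists q, m = d * q + c.
Proof. by move=> <-; exists (m %/ d)%Z; rewrite mulrC -divz_eq. Qed.

Lemma tk_odd : (tk %% 2)%Z = 1.
Proof.
rewrite /tk; have [a ->] := modz_decomp p_mod4.
by have /dvdzP[e ->] := dvd16_t; clear; lia.
Qed.

Lemma tk_sqr_mod8 : (tk ^+ 2 %% 8)%Z = 1.
Proof.
rewrite /tk; have [a ->] := modz_decomp p_mod4.
by have /dvdzP[e ->] := dvd16_t; clear; lia.
Qed.

Lemma tu_mod4 : (tu %% 4)%Z = 1.
Proof.
rewrite /tu; have [b ->] := modz_decomp r_mod4.
have [c ->] := modz_decomp s_mod4.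
by have /dvdzP[e ->] := dvd16_t; clear; lia.
Qed.

Lemma tv_mod4 : (tv %% 4)%Z = 3.
Proof.
rewrite /tv; have [a ->] := modz_decomp p_mod4.
have [c ->] := modz_decomp s_mod4.
by have /dvdzP[e ->] := dvd16_t; clear; lia.
Qed.

Lemma tw_mod4 : (tw %% 4)%Z = 1.
Proof.
rewrite /tw; have [a ->] := modz_decomp p_mod4.
have [b ->] := modz_decomp r_mod4.
by have /dvdzP[e ->] := dvd16_t; clear; lia.
Qed.

Lemma translate_dist_dvd : (t %| abscissa tu tk - 24 * tk ^+ 2)%Z.
Proof. by rewrite translate_dist -mulrA dvdz_mull // dvdz_mulr. Qed.

Lemma translate_dist_neq0 : abscissa tu tk - 24 * tk ^+ 2 != 0.
Proof.
rewrite translate_dist !mulf_neq0 //.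
(* The last factor is 2 modulo 4. *)
have [a ->] := modz_decomp p_mod4; have [b ->] := modz_decomp r_mod4.
have [c ->] := modz_decomp s_mod4.
by have /dvdzP[e ->] := dvd16_t; clear; lia.
Qed.

Lemma translate_abscissa_mod16 : (abscissa tu tk %% 16)%Z = 8.
Proof.
by have := dvdz_trans dvd16_t translate_dist_dvd; have := tk_sqr_mod8; clear; lia.
Qed.

Lemma translate_root4_mod8 : (root4 tu tv tk %% 8)%Z = 4.
Proof.
have [i ei] := modz_decomp tk_sqr_mod8.
have [j ej] := modz_decomp translate_abscissa_mod16.
rewrite /root4 ei ej.
have [y ->] := modz_decomp tu_mod4; have [z ->] := modz_decomp tv_mod4.
by clear; lia.
Qed.

End Translate.

(** The points [2 ^ (n + 1) P], in the coordinates [(p, r, s, t)]. *)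
Fixpoint point (n : nat) : int * int * int * int :=
  if n is m.+1 then
    let: (p, r, s, t) := point m in
    (p ^+ 4 - 324 * t ^+ 4, r ^+ 4 + 288 * t ^+ 4, s ^+ 4 - 2592 * t ^+ 4,
     2 * p * r * s * t)
  else (77, 73, 23, 10).

(** Doubling multiplies [t] by an odd multiple of 2: this is how [2 ^ n P] tends
    2-adically to the origin. *)
Lemma point_spec (n : nat) : let: (p, r, s, t) := point n in
  [/\ r ^+ 2 = p ^+ 2 - 6 * t ^+ 2, s ^+ 2 = p ^+ 2 - 54 * t ^+ 2,
      [/\ (p %% 2)%Z = 1, (r %% 2)%Z = 1 & (s %% 2)%Z = 1],
      (2 ^+ n.+1 %| t)%Z & t != 0].
Proof.
elim: n => [|n] //=; case: (point n) => [[[p r] s] t] [hr hs [op or os] dt t0].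
have even_t : (2 %| t)%Z.
  by apply: dvdz_trans dt; rewrite exprS dvdz_mulr.
have nz (m : int) : (m %% 2)%Z = 1 -> m != 0.
  by move=> om; apply/eqP => m0; move: om; rewrite m0.
split; first exact: double_r.
- exact: double_s.
- have odd4 (m c : int) : (m %% 2)%Z = 1 -> ((m ^+ 4 + 2 * c) %% 2)%Z = 1.
    by move=> /modz_decomp[q ->]; clear; lia.
  split.
  + by have := odd4 p (- 162 * t ^+ 4) op; congr (_ = _); congr modz; ring.
  + by have := odd4 r (144 * t ^+ 4) or; congr (_ = _); congr modz; ring.
  + by have := odd4 s (- 1296 * t ^+ 4) os; congr (_ = _); congr modz; ring.
- rewrite exprS (_ : 2 * p * r * s * t = 2 * t * (p * r * s)); last by ring.
  by rewrite dvdz_mulr // dvdz_mul.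
- by rewrite !mulf_neq0 // nz.
Qed.

(** Fourth powers of odd numbers are 1 modulo 4, so that the signs of the
    coordinates are controlled after one doubling. *)
Lemma point_mod4 (n : nat) : let: (p, r, s, _) := point n.+1 in
  [/\ (p %% 4)%Z = 1, (r %% 4)%Z = 1 & (s %% 4)%Z = 1].
Proof.
have := point_spec n => /=; case: (point n) => [[[p r] s] t] [_ _ [op or os] _ _].
have mod4 (m c : int) : (m %% 2)%Z = 1 -> ((m ^+ 4 + 4 * c) %% 4)%Z = 1.
  by move=> /modz_decomp[q ->]; clear; lia.
split.
- by have := mod4 p (- 81 * t ^+ 4) op; congr (_ = _); congr modz; ring.
- by have := mod4 r (72 * t ^+ 4) or; congr (_ = _); congr modz; ring.
- by have := mod4 s (- 648 * t ^+ 4) os; congr (_ = _); congr modz; ring.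
Qed.

(* Three doublings make [t] divisible by 16. *)
Definition family (n : nat) : {fset int} :=
  let: (p, r, s, t) := point n.+3 in
  quint (tu p r s t) (tv p r s t) (tw p r s t) (tk p t).

Lemma family_spec (n : nat) :
  [/\ forall a, a \in family n -> perfect_square a,
      exists n1 : int, 0 < n1 /\ D_quintuple n1 (family n),
      0 \notin family n & (n <= spread (family n))%N].
Proof.
rewrite /family; have := point_mod4 n.+2; have := point_spec n.+3.
case: (point n.+3) => [[[p r] s] t] [hr hs _ dt t0] [p4 r4 s4].
have d16 : (16 %| t)%Z.
  apply: dvdz_trans dt; rewrite (_ : 16 = 2 ^+ 4) //.
  by rewrite (exprD 2 4 n) dvdz_mulr.
have hv := translate_v hr hs; have hw := translate_w hr hs.
have tu4 := tu_mod4 p r4 s4 d16; have tw4 := tw_mod4 s p4 r4 d16.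
have ou : (tu p r s t %% 2)%Z = 1 by move: tu4; clear; lia.
have ow : (tw p r s t %% 2)%Z = 1 by move: tw4; clear; lia.
have ok := tk_odd p4 d16.
have x16 := translate_abscissa_mod16 hr hs p4 d16.
have r8 := translate_root4_mod8 hr hs p4 r4 s4 d16.
have dt_dist := translate_dist_dvd hr hs.
have d16_dist := dvdz_trans d16 dt_dist.
have dist0 := translate_dist_neq0 hr hs p4 r4 s4 d16 t0.
split; first exact: quint_square.
- exists (shift (tu p r s t) (tk p t)); split; first exact: shift_gt0.
  split; first exact: quintuple_quint.
  exact: quint_shift.
- exact: quint_neq0.
- apply: leq_trans (spread_quint hv hw ou ow ok x16 r8 d16_dist dist0
    (dvdz_trans dt dt_dist)).
  by clear; lia.
Qed.

Theorem theorem1 :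
  infinitely_many_pairwise_nonequivalent
    (fun A : {fset int} =>
       (forall a : int, a \in A -> perfect_square a) /\
       (exists n1 : int, 0 < n1 /\ D_quintuple n1 A)) /\
  infinitely_many_pairwise_nonequivalent
    (fun A : {fset int} =>
       exists n1 n2 : int,
         [/\ n1 != n2, D_quintuple n1 A & D_quintuple n2 A]).
Proof.
split; apply: (@infinitely_many_of_unbounded_spread _ family) => n;
  have [sq [n1 [n1_gt0 Dn1]] n0 leqs] := family_spec n => //.
  by split=> //; exists n1.
exists n1, 0; split=> //; first by rewrite gt_eqF.
split=> [|a b aA bA _]; first by case: Dn1.
have [c ->] := sq a aA; have [d ->] := sq b bA.
by exists (c * d); rewrite addr0 exprMn.
Qed.
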